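(* There exists $r_0$ such that for every integer $r\geq r_0$, $$b_{r,S_3}\leq \left(\frac{r\,((2r-1)!)^2}{2^{2r-2}}\right)^{\frac{2r-1}{8r-6}}.$$ Moreover, as $r\to\infty$ the right-hand side is asymptotically equivalent to $\frac{2^{1/8}}{e^{1/4}}\left(\frac{(2r)!}{2^r}\right)^{1/2}\approx 0.85\left(\frac{(2r)!}{2^r}\right)^{1/2}$.
   Context: For a positive integer $t$, $S_t$ denotes the star with $t$ edges (and $t+1$ vertices). For a positive integer $r$ and graphs $G,H$ (simple graphs), $c_{r,H}(G)$ is the number of $r$-edge-colorings of $G$ (functions $c:E(G)\to\{1,\dots,r\}$) with no monochromatic copy of $H$ as a subgraph. $c_{r,H}(n)$ is the maximum of $c_{r,H}(G)$ over all graphs $G$ on $n$ vertices. For connected $H$, the function $n\mapsto c_{r,H}(n)$ is supermultiplicative, so the limit $b_{r,H}=\lim_{n\to\infty} c_{r,H}(n)^{1/n}\in\mathbb{R}\cup\{\infty\}$ exists. *)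

(* Defs.v *)
From HB Require Import structures.
From mathcomp Require Import all_boot all_order all_algebra.
From mathcomp Require Import all_classical all_reals all_analysis.
Import Order.TTheory GRing.Theory Num.Theory numFieldNormedType.Exports.

Set Implicit Arguments.
Unset Strict Implicit.
Unset Printing Implicit Defensive.

Local Open Scope ring_scope.

(* A finite simple graph: its edges are two-element sets of vertices. *)
Record sgraph (T : finType) := SGraph {
  edges :> {set {set T}};
  edges_card2 : [forall e in edges, #|e| == 2%N] }.

HB.instance Definition _ (T : finType) := [isSub for @edges T].
HB.instance Definition _ (T : finType) := [Finite of sgraph T by <:].

Definition edge (T : finType) (G : sgraph T) : finType :=
  {e : {set T} | e \in edges G}.

Definition coloring (r : nat) (T : finType) (G : sgraph T) : finType :=
  {ffun edge G -> 'I_r}.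

(* f embeds H in G as a (not necessarily induced) subgraph, all of whose edges
   have colour k under c. *)
Definition mono_copy (r : nat) (T U : finType) (G : sgraph T) (H : sgraph U)
    (c : coloring r G) (f : {ffun U -> T}) (k : 'I_r) : bool :=
  injectiveb f &&
  [forall e in edges H, [exists d : edge G, (val d == f @: e) && (c d == k)]].

Definition mono_free (r : nat) (T U : finType) (G : sgraph T) (H : sgraph U)
    (c : coloring r G) : bool :=
  ~~ [exists f : {ffun U -> T}, [exists k : 'I_r, mono_copy H c f k]].

Definition num_colorings (r : nat) (U : finType) (H : sgraph U)
    (T : finType) (G : sgraph T) : nat :=
  #|[set c : coloring r G | mono_free H c]|.

Definition max_colorings (r : nat) (U : finType) (H : sgraph U) (n : nat) : nat :=
  (\max_(G : sgraph 'I_n) num_colorings r H G)%N.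

Definition colorings_root (R : realType) (r : nat) (U : finType)
    (H : sgraph U) (n : nat) : \bar R :=
  ((max_colorings r H n)%:R `^ (n%:R^-1))%:E.

(* This is the intended quantity only when [colorings_root R r H] converges in
   the extended reals. *)
Definition growth_rate (R : realType) (r : nat) (U : finType)
    (H : sgraph U) : \bar R :=
  limn (colorings_root R r H).

Definition star_edges (t : nat) : {set {set 'I_t.+1}} :=
  [set [set ord0; lift ord0 i] | i : 'I_t].

Lemma star_edges_card2 (t : nat) : [forall e in star_edges t, #|e| == 2%N].
Proof. by apply/forall_inP => e /imsetP[i _ ->]; rewrite cards2. Qed.

Definition star (t : nat) : sgraph 'I_t.+1 := SGraph (star_edges_card2 t).

(* Main.v *)
(* A coloring avoids a monochromatic S_3 iff every color appears at most twice
   at every vertex. At a vertex of degree 2r the color of one edge is forced by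
   the others, so edges can be discarded until all degrees are at most
   m = 2r - 1. Shearer's inequality is then applied to the double stars
   (the edges meeting a given edge), topped up by single edges so that every
   edge is covered exactly 2m - 1 = 4r - 3 times. The trace of the colorings on
   the double star of uv has at most r g(d(u) - 1) g(d(v) - 1) elements, where
   g(k) counts the words of length k in which one color is used at most once
   and the others at most twice. Regrouping by vertices, the square of the
   product is a product of contributions of single vertices, which for large r
   are maximal at degree m; there they equal X^m with
   X = r ((2r - 1)!)^2 / 2^(2r - 2). Fekete's lemma gives the limit, and the
   asymptotic form only needs n ln n - n <= ln n! <= (n + 1) ln (n + 1) - n. *)
Require Import Defs.
From HB Require Import structures.
From mathcomp Require Import all_boot all_order all_algebra all_field.
From mathcomp Require Import all_classical all_reals all_analysis.
From mathcomp Require Import zify ring lra.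
Import Order.TTheory GRing.Theory Num.Theory numFieldNormedType.Exports.

Set Implicit Arguments.
Unset Strict Implicit.
Unset Printing Implicit Defensive.

Local Open Scope ring_scope.

(** * Hölder's inequality and Shearer's inequality *)

(** Hölder's inequality with equal exponents, raised to the power [#|A|] so that it stays in [nat].
    It follows from the AM-GM inequality for the normalised terms [x i c / X i], summed over [c];
    [algC] supplies the roots. *)
Lemma holder_expn (I C : finType) (A : {pred I}) (b : nat) (y : C -> nat)
    (x : I -> C -> nat) :
  (0 < #|A|)%N -> (forall c, y c ^ #|A| <= b * \prod_(i in A) x i c)%N ->
  ((\sum_c y c) ^ #|A| <= b * \prod_(i in A) \sum_c x i c)%N.
Proof.
set n := #|A| => n_gt0 yx.
pose X i := (\sum_c x i c)%N.
have [/existsP[i0 /andP[Ai0 /eqP X0]]|] := boolP [exists i, (i \in A) && (X i == 0)%N].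
  suff -> : (\sum_c y c = 0)%N by rewrite exp0n.
  apply: big1 => c _; apply/eqP; rewrite -leqn0 -(leq_exp2r _ _ n_gt0) exp0n //.
  apply: leq_trans (yx c) _; rewrite (bigD1 i0) //=.
  suff -> : (x i0 c = 0)%N by rewrite mul0n muln0.
  by apply/eqP; rewrite -leqn0 -X0 /X (bigD1 c) //= leq_addr.
move/existsPn => Xn0.
have Xgt0 i : i \in A -> 0 < (X i)%:R :> algC.
  by move=> Ai; have := Xn0 i; rewrite Ai /= ltr0n lt0n.
have n0 : n%:R != 0 :> algC by rewrite pnatr_eq0 -lt0n.
pose P := n.-root (b%:R * \prod_(i in A) (X i)%:R : algC).
have P0 : 0 <= P.
  by rewrite rootC_ge0 // mulr_ge0 ?ler0n // prodr_ge0 // => i _; rewrite ler0n.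
(* The means on the right add up to 1 over all [c], since for each [i] the terms [x i c / X i]
   do. *)
have key c : (y c)%:R <= P * ((\sum_(i in A) (x i c)%:R / (X i)%:R) / n%:R).
  have h0 : {in A, forall i, 0 <= (x i c)%:R / (X i)%:R :> algC}.
    by move=> i Ai; rewrite divr_ge0 ?ler0n.
  have := leif_rootC_AGM h0; rewrite -/n => -[h _].
  apply: le_trans (ler_wpM2l P0 h).
  rewrite -rootCMl; last by rewrite mulr_ge0 ?ler0n ?prodr_ge0 // => i _; rewrite ler0n.
  rewrite -mulrA -big_split /=.
  rewrite -(@ler_pXn2r _ n) ?nnegrE ?ler0n ?rootC_ge0 //; last first.
    by rewrite mulr_ge0 ?ler0n ?prodr_ge0 // => i Ai; rewrite mulr_ge0 ?h0 ?ler0n.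
  rewrite rootCK // -natrX.
  rewrite (eq_bigr (fun i => (x i c)%:R)); last first.
    by move=> i Ai; rewrite mulrC divfK // gt_eqF ?Xgt0.
  by rewrite -natr_prod -natrM ler_nat; apply: yx.
have: (\sum_c y c)%:R <= P.
  rewrite natr_sum; apply: le_trans (ler_sum _ (fun c _ => key c)) _.
  rewrite -mulr_sumr -mulr_suml exchange_big /=.
  rewrite (eq_bigr (fun=> 1)); last first.
    by move=> i Ai; rewrite -mulr_suml -natr_sum divff // gt_eqF ?Xgt0.
  by rewrite sumr_const -/n divff // mulr1.
move=> h; have : (\sum_c y c)%:R ^+ n <= P ^+ n.
  by rewrite ler_pXn2r ?nnegrE ?ler0n.
by rewrite rootCK // -natrX -natr_prod -natrM ler_nat.
Qed.

Section Shearer.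
Variables (E C : finType) (c0 : C).
Implicit Types (f g : {ffun E -> C}) (F : {set {ffun E -> C}}) (S D : {set E}).

(** Restriction to [S], encoded by overwriting with [c0] outside [S], so that traces on different
    sets share one type. *)
Definition proj S f : {ffun E -> C} := [ffun e => if e \in S then f e else c0].
Definition fiber F e c := [set f in F | f e == c].

Lemma projP S f g : reflect {in S, f =1 g} (proj S f == proj S g).
Proof.
apply: (iffP eqP) => [/ffunP h e eS|h]; first by have := h e; rewrite !ffunE eS.
by apply/ffunP => e; rewrite !ffunE; case: ifP => // /h.
Qed.

Lemma proj_proj S D f : S \subset D -> proj S (proj D f) = proj S f.
Proof.
by move=> sSD; apply/eqP/projP => e eS; rewrite ffunE (fintype.subsetP sSD).
Qed.

Lemma imset_proj_proj S D F : S \subset D -> proj S @: (proj D @: F) = proj S @: F.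
Proof.
by move=> sSD; rewrite -imset_comp; apply: eq_imset => f /=; rewrite proj_proj.
Qed.

Lemma card_proj_sub S D F : S \subset D -> (#|proj S @: F| <= #|proj D @: F|)%N.
Proof. by move=> sSD; rewrite -(imset_proj_proj _ sSD) leq_imset_card. Qed.

(** Once the value at [e] is fixed, forgetting it loses nothing. *)
Lemma card_proj_split S F e : e \in S ->
  (#|proj S @: F| = \sum_c #|proj (S :\ e) @: fiber F e c|)%N.
Proof.
move=> eS; rewrite -sum1_card (partition_big (fun g => g e) predT) //=.
apply: eq_bigr => c _; rewrite sum1_card.
have -> : proj (S :\ e) @: fiber F e c
        = proj (S :\ e) @: [set g in proj S @: F | g e == c].
  have -> : [set g in proj S @: F | g e == c] = proj S @: fiber F e c.
    apply/setP => g; apply/idP/imsetP.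
      rewrite inE => /andP[/imsetP[f Ff ->]]; rewrite ffunE eS => fe.
      by exists f; rewrite // inE Ff.
    move=> [f /[!inE]/andP[Ff fe] ->].
    by rewrite imset_f //= ffunE eS.
  by rewrite imset_proj_proj // subD1set.
rewrite card_in_imset; first by apply: eq_card => g; rewrite !inE.
move=> g h; rewrite !inE => /andP[/imsetP[g' _ ->] /eqP ge].
move=> /andP[/imsetP[h' _ ->] /eqP he] /eqP/projP gh; apply/ffunP => e'.
have [->|e'e] := eqVneq e' e; first by rewrite ge he.
have := gh e'; rewrite !inE e'e /= => {}gh.
by case: (boolP (e' \in S)) => [/gh //|e'S]; rewrite !ffunE (negbTE e'S).
Qed.

Lemma card_projU S D F : (#|proj (S :|: D) @: F| <= #|proj S @: F| * #|proj D @: F|)%N.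
Proof.
rewrite -cardsX.
have inj : {in proj (S :|: D) @: F &, injective (fun f => (proj S f, proj D f))}.
  move=> g h /imsetP[g' _ ->] /imsetP[h' _ ->] [].
  rewrite !proj_proj ?finset.subsetUl ?finset.subsetUr // => /eqP/projP hS /eqP/projP hD.
  by apply/eqP/projP => e /setUP[/hS|/hD].
rewrite -(card_in_imset inj); apply/subset_leq_card/fintype.subsetP.
move=> _ /imsetP[_ /imsetP[f Ff ->] ->].
by rewrite inE /= !proj_proj ?finset.subsetUl ?finset.subsetUr // !imset_f.
Qed.

Lemma card_proj0 F : (#|proj finset.set0 @: F| <= 1)%N.
Proof.
rewrite (leq_trans (subset_leq_card (_ : _ \subset [set [ffun=> c0]]))) ?cards1 //.
apply/fintype.subsetP => _ /imsetP[f _ ->]; rewrite inE; apply/eqP/ffunP => e.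
by rewrite !ffunE inE.
Qed.

(** Induction on [#|D|]: remove an element [e] and apply the induction hypothesis to each fiber over
    the value at [e]. Summing over the values, Hölder's inequality recombines the [k] sets that
    contain [e]. *)
Lemma shearer (I : finType) (k : nat) (S : I -> {set E}) D F : (0 < k)%N ->
    {in D, forall e, #|[set i | e \in S i]| = k} ->
  (#|proj D @: F| ^ k <= \prod_i #|proj (S i :&: D) @: F|)%N.
Proof.
move=> k_gt0; elim: {D}#|D| {-2}D (erefl #|D|) F => [|n IH] D.
  move/cards0_eq=> -> F _; have [->|[f Ff]] := set_0Vmem F.
    by rewrite imset0 cards0 exp0n.
  rewrite (leq_trans (_ : _ <= 1 ^ k)%N) ?leq_exp2r ?card_proj0 ?exp1n //.
  rewrite big_seq_cond; apply: prodn_cond_gt0 => i _; apply/card_gt0P.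
  by eexists; apply: imset_f Ff.
move=> cD F covD; have /card_gt0P[e eD] : (0 < #|D|)%N by rewrite cD.
have cD' : #|D :\ e| = n by move: cD; rewrite (cardsD1 e) eD => -[].
have cov' : {in D :\ e, forall e', #|[set i | e' \in S i]| = k}.
  by move=> e' /setD1P[_ /covD].
rewrite (card_proj_split _ eD).
pose A := [set i | e \in S i]; have cA : #|A| = k by apply: covD.
have SD i : i \in A -> (S i :&: D) :\ e = S i :&: (D :\ e).
  by rewrite finset.setIDA.
(* [B] collects the sets that miss [e]. Bounding a fiber by all of [F] there makes it independent of
   [c], as the constant in [holder_expn] must be. *)
pose B := (\prod_(i | i \notin A) #|proj (S i :&: D) @: F|)%N.
have step c : (#|proj (D :\ e) @: fiber F e c| ^ #|A|
     <= B * \prod_(i in A) #|proj ((S i :&: D) :\ e) @: fiber F e c|)%N.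
  rewrite cA; apply: leq_trans (IH _ cD' _ cov') _; rewrite (bigID (mem A)) /= mulnC.
  apply: leq_mul; last by apply: eq_leq; apply: eq_bigr => i /SD ->.
  apply: leq_prod => i; rewrite inE => eSi.
  have -> : S i :&: D = S i :&: (D :\ e).
    apply/setP => e'; rewrite !inE; case: eqVneq => // ->.
    by rewrite (negbTE eSi).
  by apply/subset_leq_card/imsetS/fintype.subsetP => f /[!inE]/andP[].
have := holder_expn _ step; rewrite cA => /(_ k_gt0) /leq_trans; apply.
rewrite [leqRHS](bigID (mem A)) /= mulnC leq_mul2r; apply/orP; right.
rewrite leq_eqVlt; apply/orP; left; apply/eqP; apply: eq_bigr => i; rewrite inE => eS.
by rewrite (@card_proj_split _ _ e) // inE eS.
Qed.
End Shearer.

(** * Counting words with bounded letter multiplicities *)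

Local Open Scope nat_scope.

(* The number of words of length d over a letters that may be used twice and
   b letters that may be used once. *)
Fixpoint words (d a b : nat) : nat :=
  if d is d'.+1 then (a * words d' a.-1 b.+1 + b * words d' a b.-1)%N else 1%N.

(** One slot stays free, so a word extends in exactly one way to a word using every slot, and there
    are [(d + 1)! / 2 ^ a] of those. *)
Lemma words_almost_full d a b :
  (2 * a + b = d.+1)%N -> (words d a b * 2 ^ a = d.+1`!)%N.
Proof.
elim: d a b => [|d IH] a b hd; first by have [-> ->] : a = 0%N /\ b = 1%N by lia.
rewrite [words _ _ _]/=.
have hb : (b * words d a b.-1 * 2 ^ a = b * d.+1`!)%N.
  by case: b hd => // b hd; rewrite -mulnA IH //=; lia.
have ha : (a * words d a.-1 b.+1 * 2 ^ a = 2 * a * d.+1`!)%N.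
  case: a hd {hb} => // a hd.
  by rewrite -(IH a b.+1) /=; [rewrite expnS; ring | lia].
by rewrite mulnDl ha hb -mulnDl hd [in RHS]factS.
Qed.

(** There are [(d + 2)! / 2 ^ a] words using every slot. A prefix of length [d] either misses two
    distinct letters and has two completions, or misses both copies of one letter and has one
    completion; the latter prefixes number [a * d! / 2 ^ (a - 1)]. *)
Lemma words_two_missing d a b :
  (2 * a + b = d.+2)%N ->
  (words d a b * 2 ^ a.+1 = d`! * (d.+2 * d.+1 + 2 * a))%N.
Proof.
elim: d a b => [|d IH] a b hd.
  by have [[-> ->]|[-> ->]] : (a = 0 /\ b = 2) \/ (a = 1 /\ b = 0)%N by lia.
rewrite [words _ _ _]/=.
have hb : (b * words d a b.-1 * 2 ^ a.+1 = b * (d`! * (d.+2 * d.+1 + 2 * a)))%N.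
  by case: b hd => // b hd; rewrite -mulnA IH //=; lia.
have ha : (a * words d a.-1 b.+1 * 2 ^ a.+1
          = 2 * a * (d`! * (d.+2 * d.+1 + 2 * a.-1)))%N.
  case: a hd {hb} => // a hd.
  by rewrite -(IH a b.+1) /=; [rewrite expnS; ring | lia].
rewrite mulnDl ha hb [in RHS]factS.
case: a hd {ha hb} => [|a] hd; first by rewrite (_ : b = d.+3) /=; [ring | lia].
have hs : d.+1 = (2 * a + b)%N by lia.
by rewrite /= hs; ring.
Qed.

(** At least three slots are free and a letter owns at most two of them, so every word can be
    continued by at least two letters. *)
Lemma words_growth d a b :
  (d.+3 <= 2 * a + b)%N -> (2 * words d a b <= words d.+1 a b)%N.
Proof.
elim: d a b => [|d IH] a b hd; first by rewrite /= !muln1; lia.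
rewrite [words d.+2 _ _]/= -/(words d.+1 a.-1 b.+1) -/(words d.+1 a b.-1).
rewrite [words d.+1 a b]/= mulnDr !(mulnCA 2); apply: leq_add.
  by case: a hd => // a hd; rewrite leq_mul2l IH ?orbT //=; lia.
by case: b hd => // b hd; rewrite leq_mul2l IH ?orbT //=; lia.
Qed.

Section Caps.
Variables (E C : finType) (c0 : C).
Implicit Types (S : {set E}) (F : {set {ffun E -> C}}).

(** The elements of [S] receive their colors one at a time; giving one of them the color [c] lowers
    the cap of [c] by one, which is the recursion of [words]. *)
Lemma card_proj_caps S F (cap : C -> nat) :
    (forall c, cap c <= 2)%N ->
    (forall f, f \in F -> forall c, #|[set e in S | f e == c]| <= cap c)%N ->
  (#|proj c0 S @: F| <=
     words #|S| #|[set c | cap c == 2]| #|[set c | cap c == 1%N]|)%N.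
Proof.
elim: {S}#|S| {-2}S (erefl #|S|) F cap => [|n IH] S cS F cap cap2 hF.
  by rewrite (cards0_eq cS) cards0; apply: card_proj0.
have /card_gt0P[e eS] : (0 < #|S|)%N by rewrite cS.
have cS' : #|S :\ e| = n by move: cS; rewrite (cardsD1 e) eS => -[].
rewrite (card_proj_split _ _ eS) cS [words _ _ _]/=.
set a := #|_|; set b := #|_|.
(* A color of cap 2 moves to the colors of cap 1, a color of cap 1 is used up, and a color of cap 0
   cannot occur at [e]. *)
apply: (@leq_trans (\sum_c ((cap c == 2) * words n a.-1 b.+1
                       + (cap c == 1%N) * words n a b.-1))%N); last first.
  rewrite big_split /= -!big_distrl /=.
  have card_sum (k : nat) : (\sum_c (cap c == k) = #|[set c | cap c == k]|)%N.
    by rewrite -sum1_card [RHS]big_mkcond; apply: eq_bigr => c _; rewrite inE; case: eqP.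
  by rewrite !card_sum.
apply: leq_sum => c _.
pose cap' := fun c' => if c' == c then (cap c).-1 else cap c'.
have hF' : cap c != 0%N -> forall f, f \in fiber F e c -> forall c',
    (#|[set e' in S :\ e | f e' == c']| <= cap' c')%N.
  move=> capc f; rewrite inE => /andP[Ff /eqP fe] c'; rewrite /cap'.
  have := hF f Ff c'; rewrite (cardsD1 e) inE eS fe /=.
  have -> : [set e' in S | f e' == c'] :\ e = [set e' in S :\ e | f e' == c'].
    by apply/setP => e'; rewrite !inE andbA.
  by rewrite eq_sym; case: eqP => [->|_]; rewrite ?add0n //; case: (cap c) capc.
have cap'2 c' : (cap' c' <= 2)%N.
  by rewrite /cap'; case: ifP => _; rewrite ?cap2 // (leq_trans (leq_pred _)) ?cap2.
have := cap2 c; case capc : (cap c) => [|[|[|//]]] _.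
- rewrite (_ : fiber F e c = finset.set0) ?imset0 ?cards0 //.
  apply/setP => f; rewrite !inE; apply/negP => /andP[Ff /eqP fe].
  by have := hF f Ff c; rewrite capc leqn0 cards_eq0 => /eqP/setP/(_ e); rewrite !inE eS fe eqxx.
- rewrite mul0n add0n mul1n.
  have -> : a = #|[set c' | cap' c' == 2]|.
    by apply: eq_card => c'; rewrite !inE /cap'; case: (eqVneq c' c) => [->|_] /=; rewrite ?capc.
  have -> : b.-1 = #|[set c' | cap' c' == 1%N]|.
    rewrite /b (cardsD1 c) inE capc /=; apply: eq_card => c'.
    by rewrite !inE /cap'; case: (eqVneq c' c) => [->|_] /=; rewrite ?capc.
  by rewrite -cS'; apply: IH => //; apply: hF'; rewrite capc.
rewrite mul0n addn0 mul1n.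
have -> : a.-1 = #|[set c' | cap' c' == 2]|.
  rewrite /a (cardsD1 c) inE capc /=; apply: eq_card => c'.
  by rewrite !inE /cap'; case: (eqVneq c' c) => [->|_] /=; rewrite ?capc.
have -> : b.+1 = #|[set c' | cap' c' == 1%N]|.
  rewrite (cardsD1 c) inE /cap' eqxx capc /=; congr _.+1; apply: eq_card => c'.
  by rewrite !inE; case: (eqVneq c' c) => [->|_] /=; rewrite ?capc.
by rewrite -cS'; apply: IH => //; apply: hF'; rewrite capc.
Qed.
End Caps.

(** * Shearer's inequality for double stars *)

Lemma expn_prodl (I : Type) (s : seq I) (P : pred I) (x : I -> nat) k :
  ((\prod_(i <- s | P i) x i) ^ k = \prod_(i <- s | P i) x i ^ k)%N.
Proof. by apply: (big_morph (expn^~ k)) => [a b|]; rewrite ?expnMn ?exp1n. Qed.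

Lemma expn_sumr (I : Type) (s : seq I) (P : pred I) (x : I -> nat) k :
  (k ^ (\sum_(i <- s | P i) x i) = \prod_(i <- s | P i) k ^ x i)%N.
Proof. by apply: (big_morph (expn k)) => // a b; rewrite expnD. Qed.

(** The square of the share of an end of degree [k] in the bound for one edge: the color of the edge
    gives a factor [r] that its two ends split evenly, and the repeated singletons give
    [r ^ (m - k)]. In [words] one color has a single slot because the edge itself has taken the
    other. *)
Definition vertex_weight (r m k : nat) :=
  (r ^ (2 * (m - k)).+1 * words k.-1 r.-1 1 ^ 2)%N.

Section DoubleStars.
Variables (T E C : finType) (ends : E -> {set T}) (c0 : C).
Variable F : {set {ffun E -> C}}.
Hypothesis ends_inj : injective ends.
Hypothesis card_ends : forall e, #|ends e| = 2.
Hypothesis deg2 : forall f, f \in F -> forall u c,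
  (#|[set e | (u \in ends e) && (f e == c)]| <= 2)%N.

Definition incident (D : {set E}) (u : T) := [set e in D | u \in ends e].

(** [D] is a smallest edge set that still determines the colorings in [F]; at a vertex of larger
    degree one more edge could be dropped. *)
Lemma exists_reduced_edges :
  exists2 D : {set E}, #|proj c0 D @: F| = #|F| &
    forall u, (#|incident D u| <= 2 * #|C| - 1)%N.
Proof.
have PT : #|proj c0 [set: E] @: F| == #|F|.
  rewrite card_in_imset // => f g _ _ /eqP/projP fg.
  by apply/ffunP => e; rewrite fg ?inE.
have [D /eqP DF Dmin] := @arg_minnP _ _ (fun D => #|proj c0 D @: F| == #|F|)
  (fun D : {set E} => #|D|) PT.
exists D => // u; rewrite leqNgt; apply/negP => du.
have C_gt0 : (0 < #|C|)%N by apply/card_gt0P; exists c0.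
have /card_gt0P[e] : (0 < #|incident D u|)%N by lia.
rewrite inE => /andP[eD ue].
have injD : {in F &, injective (proj c0 D)} by apply/imset_injP/eqP.
suff : #|proj c0 (D :\ e) @: F| == #|F|.
  by move=> /Dmin; rewrite [leqLHS](cardsD1 e) eD; lia.
apply/eqP/card_in_imset => f g Ff Fg /eqP/projP fg.
apply: injD => //; apply/eqP/projP => e' e'D.
have [->|e'e] := eqVneq e' e; last by apply: fg; rewrite !inE e'e.
apply/eqP/negPn/negP => fge.
(* [f] uses the color [g e] on at most one edge of [D] at [u]: such an edge differs from [e] and has
   the same color under [g], which also uses that color on [e]. *)
have : (#|incident D u| <= \sum_(c : C) (2 - (c == g e)))%N.
  rewrite -sum1_card (partition_big f predT) //=; apply: leq_sum => c _.
  rewrite sum1_card; case: eqP => [->|_] /=; last first.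
    rewrite subn0; apply: leq_trans (deg2 Ff u c); apply: subset_leq_card.
    by apply/fintype.subsetP => i; rewrite unfold_in !inE => /andP[/andP[_ ->]].
  rewrite subn1 -ltnS; apply: leq_trans (deg2 Fg u (g e)).
  rewrite [leqRHS](cardsD1 e) inE ue eqxx /= add1n ltnS.
  apply/subset_leq_card/fintype.subsetP => i.
  rewrite unfold_in !inE => /andP[/andP[iD ->] /eqP fi].
  have ie : i != e by apply: contraNneq fge => ie; rewrite -{1}ie fi.
  by rewrite ie /= -fg ?fi // !inE ie.
rewrite (bigD1 (g e)) //= eqxx (eq_bigr (fun=> 2)); last by move=> c /negbTE ->.
by rewrite sum_nat_const cardC1 => h; lia.
Qed.

Variable D : {set E}.
Local Notation d := (fun u => #|incident D u|).

Definition double_star e := [set e' in D | ~~ [disjoint ends e & ends e']].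

Lemma double_starE e u v : ends e = [set u; v] ->
  double_star e = incident D u :|: incident D v.
Proof.
move=> ee; apply/setP => e'; rewrite !inE ee -andb_orr; case: (e' \in D) => //=.
rewrite -setI_eq0; apply/set0Pn/orP => [[w]|[] h].
- by rewrite !inE => /andP[/orP[] /eqP ->]; [left|right].
- by exists u; rewrite !inE eqxx.
by exists v; rewrite !inE eqxx orbT.
Qed.

Lemma incidentI e u v : e \in D -> u != v -> ends e = [set u; v] ->
  incident D u :&: incident D v = [set e].
Proof.
move=> eD uv ee; apply/setP => e'; rewrite !inE; apply/idP/eqP => [|->]; last first.
  by rewrite eD ee !inE !eqxx orbT.
case/andP=> /andP[_ ue'] /andP[_ ve']; apply: ends_inj; apply/esym/eqP.
by rewrite ee eqEcard card_ends cards2 uv andbT finset.subUset !finset.sub1set ue'.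
Qed.

(** Fix the color [c] of [e]. The other edges at the two ends are then bounded separately; at each
    end [c] may occur once more and any other color twice. *)
Lemma card_proj_double_star e : e \in D ->
  (#|proj c0 (double_star e) @: F|
     <= #|C| * \prod_(u in ends e) words (d u).-1 #|C|.-1 1)%N.
Proof.
move=> eD; have /cards2P[u [v [uv ee]]] : #|ends e| == 2 by rewrite card_ends.
have eu : e \in incident D u by rewrite inE eD ee !inE eqxx.
have ev : e \in incident D v by rewrite inE eD ee !inE eqxx orbT.
rewrite (double_starE ee) (@card_proj_split _ _ _ _ _ e); last by rewrite inE eu.
rewrite ee big_setU1 ?inE // big_set1 -sum_nat_const; apply: leq_sum => c _.
rewrite finset.setDUl; apply: leq_trans (card_projU _ _ _ _) _.
have half w : e \in incident D w -> (#|proj c0 (incident D w :\ e) @: fiber F e c|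
     <= words (d w).-1 #|C|.-1 1)%N.
  move=> ew; have := @card_proj_caps _ _ c0 (incident D w :\ e) (fiber F e c)
    (fun c' => 2 - (c' == c))%N.
  have -> : #|incident D w :\ e| = (d w).-1 by rewrite (cardsD1 e (incident D w)) ew.
  have -> : [set c' | 2 - (c' == c) == 2]%N = [set~ c].
    by apply/setP => c'; rewrite !inE; case: (eqVneq c' c).
  have -> : [set c' | 2 - (c' == c) == 1]%N = [set c].
    by apply/setP => c'; rewrite !inE; case: (eqVneq c' c).
  rewrite cards1 cardsC1; apply=> [c'|f]; first by rewrite leq_subr.
  rewrite inE => /andP[Ff /eqP fe] c'.
  have := deg2 Ff w c'.
  have we : w \in ends e by move: ew; rewrite inE => /andP[].
  rewrite (cardsD1 e) inE fe we /= (eq_sym c) => h.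
  apply: leq_trans (_ : #|[set e | (w \in ends e) && (f e == c')] :\ e| <= _)%N.
    apply: subset_leq_card; apply/fintype.subsetP => i; rewrite !inE.
    by case/andP=> /andP[-> /andP[_ ->]] ->.
  by move: h; lia.
by apply: leq_mul; apply: half.
Qed.

Lemma card_proj1 e : (#|proj c0 [set e] @: F| <= #|C|)%N.
Proof.
rewrite (@card_proj_split _ _ _ _ _ e) ?inE // finset.setDv -[leqRHS]muln1 -sum_nat_const.
by apply: leq_sum => c _; apply: card_proj0.
Qed.

Variable m : nat.
Hypothesis m_gt0 : (0 < m)%N.
Hypothesis dm : forall u, (d u <= m)%N.

(* Shearer's inequality for the double stars; every edge [e] is moreover
   repeated as a singleton [\sum_(u in ends e) (m - d u)] times, so that each
   edge is covered exactly [2 * m - 1] times. *)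
Lemma double_star_bound :
  (#|proj c0 D @: F| ^ (2 * (2 * m - 1)) <= \prod_u vertex_weight #|C| m (d u) ^ d u)%N.
Proof.
pose defect e := (\sum_(u in ends e) (m - d u))%N.
(* An index is an edge, for its double star, or a numbered copy of an edge, for a singleton. A
   defect is at most [2 * m], and surplus indices get the empty set, whose trace has at most one
   element. *)
pose S (i : E + E * 'I_(2 * m)) : {set E} := match i with
  | inl e => if e \in D then double_star e else finset.set0
  | inr (e, j) => if (e \in D) && (j < defect e)%N then [set e] else finset.set0
  end.
have defect_le e : (defect e <= 2 * m)%N.
  rewrite -[leqRHS](_ : \sum_(u in ends e) m = _)%N; last first.
    by rewrite sum_nat_const card_ends.
  by apply: leq_sum => u _; rewrite leq_subr.
have cov : {in D, forall e, #|[set i | e \in S i]| = 2 * m - 1}%N.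
  move=> e eD; have /cards2P[u [v [uv ee]]] : #|ends e| == 2 by rewrite card_ends.
  rewrite -sum1_card big_mkcond big_sumType /=.
  have -> : (\sum_(e' : E) (if inl e' \in [set i | e \in S i] then 1 else 0)
      = #|double_star e|)%N.
    rewrite -[RHS]sum1_card [RHS]big_mkcond; apply: eq_bigr => e' _.
    by rewrite !inE /=; case: (e' \in D); rewrite !inE ?eD // disjoint_sym.
  have -> : (\sum_(p : E * 'I_(2 * m)) (if inr p \in [set i | e \in S i] then 1 else 0)
      = defect e)%N.
    transitivity (\sum_e' \sum_j ((e \in S (inr (e', j))) : nat))%N.
      by rewrite pair_bigA; apply: eq_bigr => -[e' j] _; rewrite inE; case: ifP.
    rewrite (bigD1 e) //= [X in (_ + X)%N]big1 ?addn0; last first.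
      move=> e' e'e; apply: big1 => j _; case: ifP; rewrite ?inE //.
      by rewrite eq_sym (negbTE e'e).
    rewrite -[RHS]card_ord -[RHS]sum1_card.
    rewrite (big_ord_widen _ (fun=> 1)%N (defect_le e)) [RHS]big_mkcond.
    by apply: eq_bigr => j _; rewrite eD; case: ltnP; rewrite !inE ?eqxx.
  (* The edge lies in [d u + d v - 1] double stars, as only [e] itself is incident to both ends; the
     [(m - d u) + (m - d v)] singletons complete this to [2 * m - 1]. *)
  have := cardsUI (incident D u) (incident D v).
  rewrite -(double_starE ee) (incidentI eD uv ee) cards1.
  rewrite /defect ee big_setU1 ?inE // big_set1 /=.
  by have := dm u; have := dm v; lia.
apply: (@leq_trans ((\prod_i #|proj c0 (S i :&: D) @: F|) ^ 2)%N).
  by rewrite mulnC expnM leq_exp2r //; apply: shearer => //; lia.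
apply: (@leq_trans ((\prod_(e in D) (#|C| * \prod_(u in ends e)
     (words (d u).-1 #|C|.-1 1 * #|C| ^ (m - d u)))) ^ 2)%N).
  rewrite leq_exp2r // big_sumType /=.
  rewrite [leqRHS](eq_bigr (fun e => (#|C| * \prod_(u in ends e) words (d u).-1 #|C|.-1 1)
     * #|C| ^ defect e)%N); last first.
    by move=> e _; rewrite -mulnA; congr (_ * _)%N; rewrite big_split /= expn_sumr.
  rewrite big_split /=; apply: leq_mul.
    rewrite [leqRHS]big_mkcond; apply: leq_prod => e _; case: ifP => eD.
      by apply: leq_trans (card_proj_double_star eD); apply: card_proj_sub; rewrite subsetIl.
    by rewrite finset.set0I card_proj0.
  rewrite (eq_bigr (fun p => #|proj c0 (S (inr (p.1, p.2)) :&: D) @: F|)); last by case.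
  rewrite -(pair_bigA _ (fun e j => #|proj c0 (S (inr (e, j)) :&: D) @: F|)) /=.
  rewrite [leqRHS]big_mkcond; apply: leq_prod => e _; case: ifP => eD; last first.
    apply: (@leq_trans (\prod_(j < 2 * m) 1)%N); last by rewrite big1_eq.
    by apply: leq_prod => j _; rewrite finset.set0I card_proj0.
  apply: (@leq_trans (\prod_(j < 2 * m) if (j < defect e)%N then #|C| else 1%N)).
    apply: leq_prod => j _; case: ltnP => _; last by rewrite finset.set0I card_proj0.
    by apply: leq_trans (card_proj1 e); apply: card_proj_sub; apply: subsetIl.
  by rewrite -big_mkcond -(big_ord_widen _ (fun=> #|C|)) // prod_nat_const card_ord.
(* Squaring turns the factor [#|C|] of each edge into one factor [#|C|] per end, so the product
   splits over the ends. *)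
rewrite expn_prodl (eq_bigr (fun e => \prod_(u in ends e) vertex_weight #|C| m (d u))%N); last first.
  move=> e _; rewrite expnMn expn_prodl.
  rewrite -[(#|C| ^ 2)%N](_ : \prod_(u in ends e) #|C| = _)%N; last first.
    by rewrite prod_nat_const card_ends.
  rewrite -big_split; apply: eq_bigr => u _ /=.
  rewrite /vertex_weight expnMn -expnM (mulnC (m - _)) (expnS #|C|) -mulnA; congr (_ * _)%N; exact: mulnC.
(* After the exchange, [u] contributes once for every edge of [D] at it, whence the exponent
   [d u]. *)
rewrite (exchange_big_dep predT) //=; apply: leq_prod => u _.
rewrite -prod_nat_const; apply: eq_leq; apply: eq_bigl => e.
by rewrite inE.
Qed.
End DoubleStars.

(** * The vertex weight is largest at full degree *)

(** While three slots are free, one more letter at least doubles the count, which is more than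
    required. In the remaining case [k.+1 = 2 * s] the exact counts give equality. *)
Lemma words_ratio s k : (k < 2 * s)%N ->
  ((2 * s).+1 * words k s 1 <= s.+1 * words k.+1 s 1)%N.
Proof.
move=> ks; have [k3|k3] := leqP k.+3 (2 * s + 1).
  apply: leq_trans (leq_mul (leqnn s.+1) (words_growth k3)).
  by rewrite mulnA leq_mul2r; apply/orP; right; lia.
have hk : k.+1 = (2 * s)%N by lia.
have h1 := @words_almost_full k.+1 s 1 ltac:(lia).
have h2 := @words_two_missing k s 1 ltac:(lia).
rewrite -(leq_pmul2r (_ : 0 < 2 ^ s.+1)%N) ?expn_gt0 //.
have -> : (s.+1 * words k.+1 s 1 * 2 ^ s.+1 = 2 * s.+1 * (words k.+1 s 1 * 2 ^ s))%N.
  by rewrite expnS; ring.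
rewrite -mulnA h2 h1.
rewrite !factS -hk; apply: eq_leq.
have -> : (k.+2 * k.+1 + k.+1 = k.+1 * (2 * s.+1))%N by rewrite hk; ring.
by ring.
Qed.

Lemma words_ratio_iter s j : (j <= 2 * s)%N ->
  ((2 * s).+1 ^ j * words (2 * s - j) s 1 <= s.+1 ^ j * words (2 * s) s 1)%N.
Proof.
elim: j => [|j IH] hj; first by rewrite subn0.
have h := @words_ratio s (2 * s - j.+1) ltac:(lia).
rewrite (_ : (2 * s - j.+1).+1 = 2 * s - j)%N in h; last by lia.
rewrite expnSr -mulnA; apply: leq_trans (leq_mul (leqnn _) h) _.
by rewrite mulnCA expnS -mulnA leq_mul2l IH ?orbT //; lia.
Qed.

(** Let [r = s.+1], [j = m - k] and [X] be the weight at degree [m]. By [words_ratio_iter] the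
    weight at degree [k] is at most [(r ^ 4 / m ^ 2) ^ j * X], so it suffices that
    [r ^ (4 * k) <= X * m ^ (2 * k)]. As [m <= r ^ 2], the worst case is [k = 2 * s], which follows
    from the square of the hypothesis. *)
Lemma vertex_weight_max s k :
  (s.+1 ^ (4 * s) * 2 ^ s <= (2 * s).+1`! * (2 * s).+1 ^ (2 * s))%N ->
  (k <= (2 * s).+1)%N ->
  (vertex_weight s.+1 (2 * s).+1 k ^ k
     <= vertex_weight s.+1 (2 * s).+1 (2 * s).+1 ^ (2 * s).+1)%N.
Proof.
set m := (2 * s).+1 => hr km.
pose g := words (2 * s) s 1; pose X := vertex_weight s.+1 m m.
have gE : (g * 2 ^ s = m`!)%N by rewrite /g words_almost_full //; lia.
have XE : X = (s.+1 * g ^ 2)%N by rewrite /X /vertex_weight subnn muln0.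
have g_gt0 : (0 < g)%N by have := fact_gt0 m; rewrite -gE muln_gt0 => /andP[].
have X_gt0 : (0 < X)%N by rewrite XE muln_gt0 expn_gt0 g_gt0.
have m_gt0 e : (0 < m ^ e)%N by rewrite expn_gt0.
have [->|k_neq0] := eqVneq k 0%N; first by rewrite expn0 expn_gt0 X_gt0.
move: km; rewrite leq_eqVlt => /orP[/eqP->//|km].
have base : (s.+1 ^ (4 * (2 * s)) <= X * m ^ (2 * (2 * s)))%N.
  apply: (@leq_trans (g ^ 2 * m ^ (2 * (2 * s)))%N); last first.
    by rewrite leq_mul2r XE leq_pmull ?orbT.
  have {}hr : (s.+1 ^ (4 * s) <= g * m ^ (2 * s))%N.
    by rewrite -(leq_pmul2r (_ : 0 < 2 ^ s)%N) ?expn_gt0 // mulnAC gE.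
  by rewrite -(leq_exp2r _ _ (ltn0Sn 1)) expnMn -!expnM -mulnA !(mulnC _ 2) in hr.
have hX : (s.+1 ^ (4 * k) <= X * m ^ (2 * k))%N.
  have c : (2 * s = k + (2 * s - k))%N by lia.
  rewrite -(leq_pmul2r (m_gt0 (2 * (2 * s - k))%N)) -mulnA -expnD -mulnDr -c.
  apply: leq_trans base; rewrite [in leqRHS]c mulnDr expnD leq_mul2l; apply/orP; right.
  rewrite !expnM; case: (2 * s - k)%N => [|t]; rewrite ?expn0 // leq_exp2r //.
  by rewrite (_ : 4 = 2 * 2)%N // expnM leq_exp2r // /m; nia.
pose j := (m - k)%N; have j_gt0 : (0 < j)%N by rewrite subn_gt0.
have hg := @words_ratio_iter s j ltac:(lia).
rewrite (_ : 2 * s - j = k.-1)%N -/m -/g in hg; last by lia.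
have hW : (vertex_weight s.+1 m k * m ^ (2 * j) <= s.+1 ^ (4 * j) * X)%N.
  rewrite -(leq_exp2r _ _ (ltn0Sn 1)) in hg.
  rewrite /vertex_weight XE -/j /= (_ : 4 * j = 2 * j + 2 * j)%N; last by lia.
  rewrite !expnMn -!expnM !(mulnC j) in hg.
  rewrite expnS expnD; set a := (s.+1 ^ (2 * j))%N.
  have -> : (s.+1 * a * words k.-1 s 1 ^ 2 * m ^ (2 * j)
          = s.+1 * a * (m ^ (2 * j) * words k.-1 s 1 ^ 2))%N by ring.
  have -> : (a * a * (s.+1 * g ^ 2) = s.+1 * a * (a * g ^ 2))%N by ring.
  by rewrite leq_mul2l hg orbT.
rewrite -(leq_pmul2r (m_gt0 (2 * j * k)%N)) expnM -expnMn.
apply: (@leq_trans ((s.+1 ^ (4 * j) * X) ^ k)%N); first by rewrite leq_exp2r // lt0n.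
rewrite -/X [Y in (_ <= _ ^ Y * _)%N](_ : m = k + j)%N; last by lia.
rewrite expnMn expnD mulnC -mulnA leq_mul2l; apply/orP; right.
rewrite -!expnM (_ : 4 * j * k = 4 * k * j)%N; last by ring.
rewrite (_ : 2 * j * k = 2 * k * j)%N; last by ring.
by rewrite !(expnM _ _ j) -expnMn leq_exp2r.
Qed.

(** * Monochromatic stars and supermultiplicativity *)

Section StarColorings.
Variables (r t : nat) (T : finType) (G : sgraph T).
Implicit Type c : coloring r G.

Lemma card_edge (e : edge G) : #|val e| = 2.
Proof. by apply/eqP; apply: (forall_inP (edges_card2 G)); apply: (valP e). Qed.

(** Edges of one color at [u] form a star centred at [u], as their other ends are distinct;
    conversely, a copy of the star puts [t] edges of one color at the image of [ord0]. *)
Lemma mono_free_starP c :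
  reflect (forall u k, #|[set e : edge G | (u \in val e) && (c e == k)]| < t)
          (mono_free (star t) c).
Proof.
apply: (iffP idP) => [|deg].
  move=> free u k; rewrite ltnNge; apply: contraNN free => tA.
  set A := [set e | _] in tA; apply/existsP.
  (* The implication provides a vertex for every edge, so that [xchoose] gives a total function;
     outside [A] any vertex will do. *)
  have other (e : edge G) : exists w, (e \in A) ==> (val e == [set u; w]) && (u != w).
    have [eA|_] := boolP (e \in A); last by exists u.
    have /cards2P[x [y [xy exy]]] : #|val e| == 2 by rewrite card_edge.
    move: eA; rewrite inE exy !inE => /andP[/orP[]/eqP-> _].
      by exists y; rewrite eqxx.
    by exists x; rewrite finset.setUC eqxx eq_sym.
  pose w e := xchoose (other e).
  have wP e : e \in A -> val e = [set u; w e] /\ u != w e.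
    by move=> eA; have /implyP/(_ eA)/andP[/eqP] := xchooseP (other e).
  pose h (i : 'I_t) : edge G := enum_val (widen_ord tA i).
  have hA i : h i \in A by apply: enum_valP.
  have h_inj : injective h by move=> i j /enum_val_inj/(congr1 val) /= ij; apply: val_inj.
  pose f : {ffun 'I_t.+1 -> T} := [ffun i => if unlift ord0 i is Some j then w (h j) else u].
  exists f; apply/existsP; exists k; apply/andP; split.
    apply/injectiveP => i j; rewrite !ffunE.
    case: unliftP => [i'|] ->; case: unliftP => [j'|] -> // hij.
    - congr (lift _ _); apply: h_inj; apply: val_inj.
      by rewrite (wP _ (hA i')).1 (wP _ (hA j')).1 hij.
    - by have := (wP _ (hA i')).2; rewrite hij eqxx.
    by have := (wP _ (hA j')).2; rewrite hij eqxx.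
  apply/forall_inP => _ /imsetP[i _ ->]; apply/existsP; exists (h i).
  rewrite imsetU1 imset_set1 !ffunE unlift_none liftK (wP _ (hA i)).1 eqxx /=.
  by have := hA i; rewrite inE => /andP[].
apply/existsP => -[f /existsP[k /andP[/injectiveP f_inj /forall_inP copy]]].
have := deg (f ord0) k; rewrite ltnNge => /negP; apply.
have cs : #|star_edges t| = t.
  rewrite card_imset ?card_ord // => i j /setP/(_ (lift ord0 i)).
  by rewrite !inE eqxx orbT => /esym /= /eqP/lift_inj.
rewrite -[leqLHS]cs -(card_imset _ (imset_inj f_inj)) -[leqRHS](card_imset _ val_inj).
apply/subset_leq_card/fintype.subsetP => _ /imsetP[e es ->].
have /existsP[d /andP[/eqP dE cd]] := copy e es.
rewrite -dE; apply: imset_f; rewrite inE cd dE andbT.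
by case/imsetP: es => i _ ->; rewrite imset_f // !inE eqxx.
Qed.
End StarColorings.

Lemma num_colorings_star3 s (T : finType) (G : sgraph T) :
  let m := (2 * s).+1 in
  s.+1 ^ (4 * s) * 2 ^ s <= m`! * m ^ (2 * s) ->
  num_colorings s.+1 (star 3) G ^ (2 * (2 * m - 1))
    <= (vertex_weight s.+1 m m ^ m) ^ #|T|.
Proof.
move=> m hs; rewrite /num_colorings; set F := [set c | _].
have deg2 f : f \in F -> forall u c, #|[set e : edge G | (u \in val e) && (f e == c)]| <= 2.
  by rewrite inE => /mono_free_starP.
have [D DF Ddeg] := exists_reduced_edges ord0 deg2.
rewrite card_ord in Ddeg.
have Ddeg' u : #|incident val D u| <= m by apply: leq_trans (Ddeg u) _; rewrite /m; lia.
rewrite -DF; apply: leq_trans (double_star_bound ord0 val_inj (@card_edge _ G) deg2 (ltn0Sn _) Ddeg') _.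
rewrite card_ord -prod_nat_const; apply: leq_prod => u _; exact: vertex_weight_max.
Qed.

Lemma empty_edges_card2 (T : finType) :
  [forall e in (finset.set0 : {set {set T}}), #|e| == 2].
Proof. by apply/forall_inP => e; rewrite inE. Qed.

Definition empty_graph (T : finType) : sgraph T := SGraph (empty_edges_card2 T).

Lemma max_colorings_attained r (U : finType) (H : sgraph U) n :
  exists G : sgraph 'I_n, max_colorings r H n = num_colorings r H G.
Proof.
have G_gt0 : 0 < #|{: sgraph 'I_n}| by apply/card_gt0P; exists (empty_graph _).
have [G e] :=
  bigop.eq_bigmax (fun G : sgraph _ => num_colorings r H G) G_gt0.
by exists G.
Qed.

Lemma max_colorings_star_gt0 s t n : 0 < max_colorings s.+1 (star t.+1) n.
Proof.
apply: leq_trans (leq_bigmax (empty_graph 'I_n)); apply/card_gt0P.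
exists [ffun=> ord0]; rewrite inE; apply/mono_free_starP => u k.
rewrite (_ : [set e | _] = finset.set0) ?cards0 //.
by apply/setP => -[e eP]; exfalso; move: eP; rewrite inE.
Qed.

Section DisjointUnion.
Variables (s t n m : nat) (G : sgraph 'I_n) (H : sgraph 'I_m).
Let l := @lshift n m.
Let r := @rshift n m.

Definition union_edges : {set {set 'I_(n + m)}} :=
  [set l @: (e : {set 'I_n}) | e in edges G] :|:
  [set r @: (e : {set 'I_m}) | e in edges H].

Lemma union_edges_card2 : [forall e in union_edges, #|e| == 2].
Proof.
apply/forall_inP => _ /setUP[]/imsetP[e eG ->].
  by rewrite (card_imset _ (@lshift_inj _ _)); apply: (forall_inP (edges_card2 G)).
by rewrite (card_imset _ (@rshift_inj _ _)); apply: (forall_inP (edges_card2 H)).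
Qed.

Definition union_graph : sgraph 'I_(n + m) := SGraph union_edges_card2.

(** The side of an edge is recognised by which preimage is an edge. The final [ord0] is a default
    that no edge of the union reaches. *)
Definition union_coloring (c : coloring s.+1 G * coloring s.+1 H) :
    coloring s.+1 union_graph :=
  [ffun d : edge union_graph => if insub (l @^-1: val d) is Some e then c.1 e
             else if insub (r @^-1: val d) is Some e then c.2 e else ord0].

Lemma left_edge_subproof (e : edge G) : l @: val e \in edges union_graph.
Proof. by rewrite inE imset_f //; apply: valP. Qed.

Lemma right_edge_subproof (e : edge H) : r @: val e \in edges union_graph.
Proof. by rewrite inE orbC imset_f //; apply: valP. Qed.

Definition left_edge e : edge union_graph :=
  exist (fun d => d \in edges union_graph) _ (left_edge_subproof e).
Definition right_edge e : edge union_graph :=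
  exist (fun d => d \in edges union_graph) _ (right_edge_subproof e).

Lemma union_coloringl c e : union_coloring c (left_edge e) = c.1 e.
Proof.
rewrite ffunE /=.
have -> : l @^-1: (l @: val e) = val e.
  by apply/setP => x; rewrite inE mem_imset //; apply: lshift_inj.
by rewrite valK.
Qed.

Lemma union_coloringr c e : union_coloring c (right_edge e) = c.2 e.
Proof.
rewrite ffunE /= insubN; last first.
  apply/negP => /(forall_inP (edges_card2 G)).
  rewrite (_ : _ @^-1: _ = finset.set0) ?cards0 //.
  by apply/setP => x; rewrite !inE; apply/negP => /imsetP[y _ /eqP]; rewrite eq_lrshift.
have -> : r @^-1: (r @: val e) = val e.
  by apply/setP => x; rewrite inE mem_imset //; apply: rshift_inj.
by rewrite valK.
Qed.

(** All edges at a vertex of the union come from one side, so no new monochromatic star arises, and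
    both colorings can be read off from the combined one. *)
Lemma num_colorings_union :
  num_colorings s.+1 (star t) G * num_colorings s.+1 (star t) H
    <= num_colorings s.+1 (star t) union_graph.
Proof.
rewrite /num_colorings -cardsX.
have inj : injective union_coloring.
  move=> [c1 c2] [d1 d2] cd; congr (_, _); apply/ffunP => e.
    by have := congr1 (fun f : coloring _ _ => f (left_edge e)) cd; rewrite !union_coloringl.
  by have := congr1 (fun f : coloring _ _ => f (right_edge e)) cd; rewrite !union_coloringr.
rewrite -(card_imset _ inj); apply/subset_leq_card/fintype.subsetP.
move=> _ /imsetP[c /[!inE] /andP[/mono_free_starP c1 /mono_free_starP c2] ->].
apply/mono_free_starP => u k; case: (split_ordP u) => v ->.
  apply: leq_ltn_trans (c1 v k); rewrite -(card_imset _ (_ : injective left_edge)); last first.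
    by move=> e e' /(congr1 val)/(imset_inj (@lshift_inj _ _))/val_inj.
  apply/subset_leq_card/fintype.subsetP => -[d dP]; rewrite inE /= => /andP[vd dk].
  have /setUP[/imsetP[e eG de]|/imsetP[e _ de]] := dP; last first.
    by rewrite de in vd; case/imsetP: vd => w _ /eqP; rewrite eq_lrshift.
  pose e' : edge G := exist (fun e => e \in edges G) e eG.
  have dE : exist (fun d => d \in edges union_graph) d dP = left_edge e'.
    exact: val_inj.
  rewrite dE union_coloringl in dk; apply/imsetP; exists e' => //.
  by rewrite inE dk andbT /=; move: vd; rewrite de mem_imset //; apply: lshift_inj.
apply: leq_ltn_trans (c2 v k); rewrite -(card_imset _ (_ : injective right_edge)); last first.
  by move=> e e' /(congr1 val)/(imset_inj (@rshift_inj _ _))/val_inj.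
apply/subset_leq_card/fintype.subsetP => -[d dP]; rewrite inE /= => /andP[vd dk].
have /setUP[/imsetP[e _ de]|/imsetP[e eH de]] := dP.
  by rewrite de in vd; case/imsetP: vd => w _ /eqP; rewrite eq_rlshift.
pose e' : edge H := exist (fun e => e \in edges H) e eH.
have dE : exist (fun d => d \in edges union_graph) d dP = right_edge e'.
  exact: val_inj.
rewrite dE union_coloringr in dk; apply/imsetP; exists e' => //.
by rewrite inE dk andbT /=; move: vd; rewrite de mem_imset //; apply: rshift_inj.
Qed.
End DisjointUnion.

Lemma max_colorings_star_supermul s t n m :
  max_colorings s.+1 (star t) n * max_colorings s.+1 (star t) m
    <= max_colorings s.+1 (star t) (n + m).
Proof.
have [G ->] := max_colorings_attained s.+1 (star t) n.
have [H ->] := max_colorings_attained s.+1 (star t) m.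
by apply: leq_trans (num_colorings_union s t G H) _; apply: leq_bigmax.
Qed.

(** * Estimates for logarithms, factorials and the constant *)

Local Open Scope ring_scope.
Section RealEstimates.
Variable R : realType.
Implicit Types x y : R.

(** Concavity: [ln] lies below its tangent at [x]. *)
Lemma ln_sub_le x y : 0 < x -> 0 < y -> ln y - ln x <= (y - x) / x.
Proof.
move=> x0 y0; rewrite -ln_div ?posrE //.
have -> : y / x = 1 + (y - x) / x by field; rewrite gt_eqF.
apply: le_ln1Dx; rewrite -subr_gt0 (_ : _ - _ = y / x) ?divr_gt0 //.
by field; rewrite gt_eqF.
Qed.

Lemma ln_factS n : ln (n.+1`!%:R : R) = ln n.+1%:R + ln n`!%:R.
Proof. by rewrite factS natrM lnM // posrE ltr0n ?fact_gt0. Qed.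

Lemma ln_fact_ge n : n%:R * ln n%:R - n%:R <= ln (n`!%:R : R).
Proof.
elim: n => [|n IH]; first by rewrite mul0r subr0 fact0 ln1.
rewrite ln_factS; have [->|n0] := posnP n; first by rewrite fact0 !ln1; lra.
have n0' : 0 < n%:R :> R by rewrite ltr0n.
have := @ln_sub_le n%:R n.+1%:R n0' (ltr0Sn _ _).
rewrite -[n.+1]addn1 natrD addrAC subrr add0r ler_pdivlMr // in IH *.
by lra.
Qed.

Lemma ln_fact_le n : ln (n`!%:R : R) <= n.+1%:R * ln n.+1%:R - n%:R.
Proof.
elim: n => [|n IH]; first by rewrite fact0 ln1 mulr0 subr0.
rewrite ln_factS.
have := @ln_sub_le n.+2%:R n.+1%:R (ltr0Sn _ _) (ltr0Sn _ _).
rewrite ler_pdivlMr // (_ : n.+2%:R = n.+1%:R + 1 :> R); last by rewrite -natr1.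
rewrite (_ : n%:R = n.+1%:R - 1) in IH; last by rewrite -natr1 addrK.
by lra.
Qed.

(* [1 + x <= expR x] at [x = 1 / 32] and [x = - 1 / 32], squared five times. *)
Lemma expR1_bounds : 265 / 100 <= expR (1 : R) <= 277 / 100.
Proof.
have pow32 (a : R) : expR (32 * a) = expR a ^+ 32 by rewrite expRM_natl.
have sq (a b : R) : 0 <= a -> a ^+ 2 >= b -> forall x, a <= x -> b <= x ^+ 2.
  by move=> a0 ab x ax; nra.
apply/andP; split.
  have e1 : 33 / 32 <= expR (1 / 32 : R) by apply: le_trans (expR_ge1Dx _); lra.
  rewrite (_ : 1 = 32 * (1 / 32) :> R) ?pow32; last by lra.
  set z := expR _ in e1 *; have -> : z ^+ 32 = ((((z ^+ 2) ^+ 2) ^+ 2) ^+ 2) ^+ 2.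
    by rewrite -!exprM.
  apply: (sq (163 / 100)); [lra|lra|].
  apply: (sq (1278 / 1000)); [lra|lra|].
  apply: (sq (11307 / 10000)); [lra|lra|].
  apply: (sq (10634 / 10000)); [lra|lra|].
  by apply: (sq (33 / 32)); [lra|lra|].
have e1 : 31 / 32 <= expR (- (1 / 32) : R) by apply: le_trans (expR_ge1Dx _); lra.
rewrite -[X in expR X]opprK expRN invf_ple ?posrE ?expR_gt0 //.
rewrite (_ : - 1 = 32 * (- (1 / 32)) :> R) ?pow32; last by lra.
set z := expR _ in e1 *; have -> : z ^+ 32 = ((((z ^+ 2) ^+ 2) ^+ 2) ^+ 2) ^+ 2.
  by rewrite -!exprM.
apply: (sq (6009 / 10000)); [lra|lra|].
apply: (sq (7752 / 10000)); [lra|lra|].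
apply: (sq (8805 / 10000)); [lra|lra|].
apply: (sq (9384 / 10000)); [lra|lra|].
by apply: (sq (31 / 32)); [lra|lra|].
Qed.

(** From [e ^ 2 <= 2 ^ 3] and [2 <= e]. *)
Lemma ln2_bounds : 2 / 3 <= ln (2 : R) <= 1.
Proof.
have /andP[e1 e2] := expR1_bounds.
apply/andP; split; last first.
  by rewrite -[leRHS](expRK 1) ler_ln ?posrE ?expR_gt0 //; lra.
suff : 2 <= 3 * ln 2 :> R by lra.
have -> : 3 * ln 2 = ln (2 ^+ 3) :> R by rewrite lnXn // mulr_natl.
rewrite [leLHS](_ : 2 = ln (expR 1 ^+ 2)); last by rewrite lnXn ?expR_gt0 // expRK.
rewrite ler_ln ?posrE ?exprn_gt0 ?expR_gt0 //.
by move: (expR 1) e1 e2 => z e1 e2; nra.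
Qed.

(** Take logarithms, with [r = s.+1]. The bounds [ln m! >= m ln m - m] and
    [ln m >= ln (2 r) - 1 / m] reduce the claim to [ln r + (3 s + 1) ln 2 >= 2 s + 3]. As
    [ln 2 >= 2 / 3], it is enough that [ln r >= 7 / 3], and [r >= 16] gives
    [ln r >= 4 ln 2 >= 8 / 3]. *)
Lemma exp_le_fact s : (15 <= s)%N ->
  (s.+1 ^ (4 * s) * 2 ^ s <= (2 * s).+1`! * (2 * s).+1 ^ (2 * s))%N.
Proof.
move=> s15; set m := (2 * s).+1.
have s0 : 15 <= s%:R :> R by rewrite (ler_nat _ 15).
rewrite -(ler_nat R) -ler_ln ?posrE ?ltr0n ?muln_gt0 ?expn_gt0 ?fact_gt0 //.
have hf := ln_fact_ge m; have F0 : 0 < m`!%:R :> R by rewrite ltr0n fact_gt0.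
rewrite (natrM _ _ (2 ^ s)) (natrM _ m`!) !natrX.
move: (m`!%:R) F0 hf => F F0 hf.
rewrite !lnM ?posrE ?exprn_gt0 ?ltr0n // !lnXn //.
rewrite -!(mulr_natr (ln _)) !natrM.
have /andP[l2 _] := ln2_bounds.
have mE : m%:R = 2 * s%:R + 1 :> R by rewrite /m -natr1 natrM.
have rE : s.+1%:R = s%:R + 1 :> R by rewrite -natr1.
have m0 : 0 < m%:R :> R by rewrite ltr0n.
have hm : ln 2 + ln s.+1%:R - ln m%:R <= m%:R^-1 :> R.
  rewrite -lnM ?posrE //; apply: le_trans (ln_sub_le _ _) _; rewrite ?mulr_gt0 //.
  by rewrite rE mE (_ : _ - _ = 1) ?mul1r //; lra.
have hr : 8 / 3 <= ln s.+1%:R :> R.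
  apply: (@le_trans _ _ (ln (2 ^+ 4))); first by rewrite lnXn // -mulr_natr; lra.
  by rewrite ler_ln ?posrE // -natrX ler_nat.
have hi : (4 * s%:R + 1) * m%:R^-1 <= 2 :> R.
  by rewrite ler_pdivrMr // mE; lra.
rewrite !mE in hf hm hi *; set lm := ln (2 * s%:R + 1) in hf hm *.
have := ler_wpM2l (_ : 0 <= 4 * s%:R + 1) hm => /(_ ltac:(lra)).
by nra.
Qed.

(** The eighth power of the constant is [2 / e ^ 2], which the bounds on [e] place between the
    eighth powers of 0.845 and 0.855. *)
Lemma const_bound :
  `|2 `^ (1 / 8) / expR (1 / 4) - 85 / 100| < 5 / 1000 :> R.
Proof.
have /andP[e1 e2] := expR1_bounds.
set z := 2 `^ (1 / 8) / _; have z0 : 0 < z by rewrite divr_gt0 ?powR_gt0 ?expR_gt0.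
have z8 : z ^+ 8 = 2 / expR 1 ^+ 2.
  have p8 : (2 `^ (1 / 8)) ^+ 8 = 2 :> R.
    by rewrite -powR_mulrn ?powR_ge0 // -powRrM (_ : _ * _ = 1) ?powRr1 //; lra.
  have q8 : expR (1 / 4) ^+ 8 = expR 1 ^+ 2 :> R.
    by rewrite -!expRM_natl; congr expR; lra.
  by rewrite /z exprMn exprVn p8 q8.
have lt8 (a b : R) : 0 <= a -> 0 <= b -> a ^+ 8 < b ^+ 8 -> a < b.
  by move=> a0 b0; rewrite ltr_pXn2r ?nnegrE.
have d0 : 0 < expR 1 ^+ 2 :> R by rewrite exprn_gt0 ?expR_gt0.
have [eb1 eb2] : 702 / 100 <= expR 1 ^+ 2 :> R /\ expR 1 ^+ 2 <= 7673 / 1000 :> R.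
  by move: (expR 1) e1 e2 => e e1 e2; split; nra.
have z1 : 845 / 1000 < z.
  apply: lt8; [lra|exact: ltW|].
  by rewrite z8 ltr_pdivlMr //; lra.
have z2 : z < 855 / 1000.
  apply: lt8; [exact: ltW|lra|].
  rewrite z8 ltr_pdivrMr //; lra.
by rewrite ltr_norml; apply/andP; split; lra.
Qed.
End RealEstimates.

(** * Fekete's lemma and limits *)

Local Open Scope classical_set_scope.

Section Limits.
Variable R : realType.

(** The limit is the supremum of the quotients. If [k.+1] nearly attains it, dividing [n] by [k.+1]
    with quotient [q] gives [u n >= q * u k.+1], the remainder contributing a nonnegative term. *)
Lemma fekete (u : nat -> R) (K : R) :
    (forall n, 0 <= u n) -> (forall n m, u n + u m <= u (n + m)%N) ->
    (forall n, u n <= n%:R * K) ->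
  exists2 l : R, u n / n%:R @[n --> \oo] --> l & l <= K.
Proof.
move=> u0 uD uK.
pose E := [set u n.+1 / n.+1%:R | n in [set: nat]].
have EK : ubound E K.
  by move=> _ [n _ <-]; rewrite ler_pdivrMr // mulrC.
have E1 : E !=set0 by exists (u 1%N / 1%:R); exists 0%N.
have supE : has_sup E by split=> //; exists K.
exists (sup E); last exact: ge_sup.
apply/cvgrPdist_le => eps eps0.
have eps2 : 0 < eps / 2 by lra.
have [_ [k _ <-] hk] := sup_adherent eps2 supE.
have umul q : q%:R * u k.+1 <= u (q * k.+1)%N.
  elim: q => [|q IH]; first by rewrite mul0r.
  by rewrite mulSn -natr1 mulrDl mul1r addrC; apply: le_trans (uD _ _); rewrite lerD2l.
near=> n.
have n_gt0 : (0 < n)%N by near: n; exact: nbhs_infty_gt.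
have n0 : 0 < n%:R :> R by rewrite ltr0n.
have un : u n / n%:R <= sup E.
  by apply: (sup_upper_bound supE); exists n.-1; rewrite ?prednK.
rewrite ger0_norm ?subr_ge0 //.
suff : u k.+1 / k.+1%:R - eps / 2 <= u n / n%:R.
  by move: hk; set a := u _ / _; set b := u n / _; set c := sup E => hk; lra.
(* This absorbs the one incomplete block lost when [n] is rounded down to a multiple of [k.+1]. *)
have hn : u k.+1 <= eps / 2 * n%:R.
  rewrite -ler_pdivrMl //; near: n; exact: nbhs_infty_ger.
rewrite ler_pdivlMr // mulrBl.
pose q := (n %/ k.+1)%N.
have hq : n%:R <= q%:R * k.+1%:R + k.+1%:R :> R.
  rewrite -natrM -natrD ler_nat [leqLHS](divn_eq n k.+1) leq_add2l.
  by rewrite ltnW ?ltn_pmod.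
have hu : q%:R * u k.+1 <= u n.
  rewrite [in leRHS](divn_eq n k.+1); apply: le_trans (umul _) _.
  by apply: le_trans (uD _ _); rewrite lerDl.
have : u k.+1 / k.+1%:R * n%:R <= q%:R * u k.+1 + u k.+1.
  rewrite mulrAC ler_pdivrMr //.
  have -> : (q%:R * u k.+1 + u k.+1) * k.+1%:R = u k.+1 * (q%:R * k.+1%:R + k.+1%:R) by ring.
  by rewrite ler_wpM2l.
by move=> hab; rewrite lerBlDr (le_trans hab) ?lerD.
Unshelve. all: by end_near.
Qed.

Lemma powR_expR (x y : R) : 0 < x -> x `^ y = expR (y * ln x).
Proof. by move=> x0; rewrite /powR gt_eqF. Qed.

(** Fekete's lemma applies to the logarithms of the maxima, which are nonnegative as the maxima are
    at least 1; continuity of [expR] carries the limit over to the roots. *)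
Lemma growth_rate_supermul (r : nat) (U : finType) (H : sgraph U) (K : R) :
    (forall n, 0 < max_colorings r H n)%N ->
    (forall n m, max_colorings r H n * max_colorings r H m
                   <= max_colorings r H (n + m))%N ->
    (forall n, ln (max_colorings r H n)%:R <= n%:R * K) ->
  cvgn (colorings_root R r H) /\ (growth_rate R r H <= (expR K)%:E)%E.
Proof.
move=> c0 cM cK; pose u n := ln (max_colorings r H n)%:R : R.
have [|n m||l ul lK] := @fekete u K.
- by move=> n; rewrite ln_ge0 // ler1n c0.
- rewrite /u -lnM ?posrE ?ltr0n ?c0 // -natrM ler_ln ?posrE ?ltr0n ?muln_gt0 ?c0 //.
  by rewrite ler_nat cM.
- exact: cK.
have rootE : colorings_root R r H = EFin \o (expR \o (fun n => u n / n%:R)).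
  by apply/funext => n /=; rewrite /colorings_root powR_expR ?ltr0n ?c0 // mulrC.
have rootl : colorings_root R r H n @[n --> \oo] --> (expR l)%:E.
  rewrite rootE; apply: cvg_EFin; first exact: nearW.
  by apply: continuous_cvg ul; apply: continuous_expR.
split; first by apply/cvg_ex; exists (expR l)%:E.
rewrite /growth_rate (cvg_lim _ rootl) // lee_fin ler_expR //.
Qed.

Lemma equivalent_expR (f g : nat -> R) (h : nat -> R) :
  (\forall n \near \oo, f n = g n * expR (h n)) ->
  h n @[n --> \oo] --> (0 : R) -> f ~_\oo g.
Proof.
move=> fgh h0; apply/eqaddoP => eps eps0; near=> n.
have fE : f n = g n * expR (h n) by near: n.
have hn : `|expR (h n) - 1| <= eps.
  near: n; apply: (cvgrPdistC_le (expR \o h) 1).1 => //.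
  by rewrite -(expR0 R); apply: continuous_cvg h0; apply: continuous_expR.
rewrite !fctE fE -[X in _ - X]mulr1 -mulrBr normrM mulrC.
by rewrite ler_wpM2r.
Unshelve. all: by end_near.
Qed.
End Limits.

(** * The asymptotic form and the final bound *)

Section Asymptotics.
Variable R : realType.

(** The vertex weight at full degree [2 r - 1], as [vertex_weight_double_star] shows. *)
Definition double_star_base (r : nat) : R :=
  r%:R * ((2 * r - 1)`!)%:R ^+ 2 / 2 ^+ (2 * r - 2).

Lemma double_star_base_gt0 r : (0 < r)%N -> 0 < double_star_base r.
Proof.
by move=> r0; rewrite !mulr_gt0 ?invr_gt0 ?exprn_gt0 ?ltr0n ?fact_gt0.
Qed.

Lemma ln_double_star_base r : (0 < r)%N ->
  ln (double_star_base r)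
    = 2 * ln ((2 * r)`!)%:R - ln r%:R - 2 * r%:R * ln 2.
Proof.
case: r => // s _; rewrite /double_star_base.
rewrite (_ : 2 * s.+1 - 1 = (2 * s).+1)%N; last by lia.
rewrite (_ : 2 * s.+1 - 2 = 2 * s)%N; last by lia.
rewrite [in RHS](_ : 2 * s.+1 = (2 * s).+2)%N; last by lia.
rewrite ln_factS (_ : (2 * s).+2 = 2 * s.+1)%N; last by lia.
have F0 : 0 < (2 * s).+1`!%:R :> R by rewrite ltr0n fact_gt0.
move: (_`!%:R) F0 => F F0.
rewrite ln_div ?posrE ?mulr_gt0 ?exprn_gt0 // lnM ?posrE ?exprn_gt0 //.
rewrite natrM lnM ?posrE // !lnXn // -!(mulr_natr (ln _)) natrM -[s.+1%:R]natr1.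
by ring.
Qed.

(** The exponents of [(2 r)!] on the two sides differ by [1 / (8 r - 6)]. The terms are grouped so
    that the last bracket is the error of approximating [ln (2 r)!] by [2 r ln (2 r) - 2 r]. *)
Lemma ln_ratio (r : nat) : (0 < r)%N ->
  ln (double_star_base r `^ ((2 * r%:R - 1) / (8 * r%:R - 6)))
    - ln (2 `^ (1 / 8) / expR (1 / 4) * (((2 * r)`!)%:R / 2 ^+ r) `^ (1 / 2))
  = (3 / 4 * ln 2 + ln r%:R - 3 / 2
      + (ln ((2 * r)`!)%:R - 2 * r%:R * (ln 2 + ln r%:R) + 2 * r%:R))
    / (8 * r%:R - 6).
Proof.
move=> r0; have r1 : 1 <= r%:R :> R by rewrite ler1n.
have F0 : 0 < (2 * r)`!%:R :> R by rewrite ltr0n fact_gt0.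
rewrite ln_powR ln_double_star_base // lnM ?posrE ?divr_gt0 ?powR_gt0 ?divr_gt0 ?exprn_gt0 ?expR_gt0 //.
rewrite ln_div ?posrE ?powR_gt0 ?expR_gt0 // !ln_powR expRK.
rewrite ln_div ?posrE ?exprn_gt0 // lnXn // -(mulr_natr (ln 2) r).
move: (ln _`!%:R) => L; field.
by apply/eqP; lra.
Qed.

(** The last bracket lies between 0 and [ln (2 r + 1) + 1], so the numerator is of order at most
    [ln r] against a linear denominator. *)
Lemma ln_ratio_cvg0 :
  (3 / 4 * ln 2 + ln r%:R - 3 / 2
      + (ln ((2 * r)`!)%:R - 2 * r%:R * (ln 2 + ln r%:R) + 2 * r%:R))
    / (8 * r%:R - 6) @[r --> \oo] --> (0 : R).
Proof.
apply/cvgrPdistC_le => /= eps eps0; near=> r.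
have r_gt0 : (0 < r)%N by near: r; exact: nbhs_infty_gt.
have r1 : 1 <= r%:R :> R by rewrite ler1n.
(* This is exactly [2 ((2 r + 1) eps - ln eps) <= (8 r - 6) eps], whose left side dominates the
   numerator by [heps]. *)
have hr : (8 * eps - 2 * ln eps) / (4 * eps) <= r%:R.
  by near: r; exact: nbhs_infty_ger.
rewrite ler_pdivrMr ?mulr_gt0 // in hr.
have hge := ln_fact_ge R (2 * r)%N; have hle := ln_fact_le R (2 * r)%N.
rewrite natrM in hge; rewrite -natr1 !natrM in hle.
have hln : ln (2 * r%:R) = ln 2 + ln r%:R :> R by rewrite lnM ?posrE //; lra.
have hln1 : ln (2 * r%:R + 1) - ln (2 * r%:R) <= (2 * r%:R)^-1 :> R.
  by apply: le_trans (ln_sub_le _ _) _; rewrite ?[_ + 1 - _]addrAC ?subrr ?add0r ?mul1r //; lra.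
have hln2 : 2 * r%:R * (ln (2 * r%:R + 1) - ln (2 * r%:R)) <= 1 :> R.
  by rewrite -ler_pdivlMl ?mulr1 //; lra.
(* The tangent of [ln] at [1 / eps] has slope [eps]. *)
have heps : ln (2 * r%:R + 1) + ln eps <= (2 * r%:R + 1) * eps - 1 :> R.
  have := @ln_sub_le R eps^-1 (2 * r%:R + 1).
  rewrite invr_gt0 lnV ?posrE // invrK opprK mulrBl mulVf ?gt_eqF //.
  by apply=> //; lra.
have hl0 : 0 <= ln r%:R :> R by rewrite ln_ge0.
have hl1 : ln r%:R <= ln (2 * r%:R + 1) :> R by rewrite ler_ln ?posrE //; lra.
have /andP[l1 l2] := ln2_bounds R.
rewrite hln in hge hln1 hln2.
move: (ln _`!%:R) hge hle => L hge hle.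
rewrite subr0 normrM normfV (gtr0_norm (_ : 0 < 8 * r%:R - 6)); last by lra.
rewrite ler_pdivrMr; last by lra.
set l2r1 := ln (2 * r%:R + 1) in hle hln2 heps hl1.
rewrite ler_norml; apply/andP; split; lra.
Unshelve. all: by end_near.
Qed.

Lemma double_star_base_equivalent :
  (fun r : nat => double_star_base r `^ ((2 * r%:R - 1) / (8 * r%:R - 6))) ~_\oo
  (fun r : nat =>
     2 `^ (1 / 8) / expR (1 / 4) * (((2 * r)`!)%:R / 2 ^+ r) `^ (1 / 2)).
Proof.
apply: equivalent_expR ln_ratio_cvg0; near=> r.
have r_gt0 : (0 < r)%N by near: r; exact: nbhs_infty_gt.
rewrite -ln_ratio //.
have F0 : 0 < (2 * r)`!%:R :> R by rewrite ltr0n fact_gt0.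
rewrite expRB !lnK ?posrE ?mulr_gt0 ?divr_gt0 ?powR_gt0 ?double_star_base_gt0
  ?divr_gt0 ?exprn_gt0 ?expR_gt0 //.
rewrite [RHS]mulrC divfK // gt_eqF ?mulr_gt0 ?divr_gt0 ?powR_gt0
  ?divr_gt0 ?exprn_gt0 ?expR_gt0 //.
Unshelve. all: by end_near.
Qed.

Lemma vertex_weight_double_star s :
  (vertex_weight s.+1 (2 * s).+1 (2 * s).+1)%:R = double_star_base s.+1.
Proof.
rewrite /double_star_base (_ : 2 * s.+1 - 1 = (2 * s).+1)%N; last by lia.
rewrite (_ : 2 * s.+1 - 2 = 2 * s)%N; last by lia.
rewrite /vertex_weight subnn muln0 expn1 /= -(@words_almost_full (2 * s) s 1); last by lia.
by rewrite !natrM !natrX exprMn -exprM (mulnC s) expr2 !mulrA mulfK //.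
Qed.

(** Logarithms of [num_colorings_star3] for an extremal graph: with [r = s.+1] and [m = 2 r - 1],
    the exponent [2 * (2 * m - 1)] is [8 r - 6]. *)
Lemma ln_max_colorings_star3 s n : (15 <= s)%N ->
  ln (max_colorings s.+1 (star 3) n)%:R <=
    n%:R * ((2 * s.+1%:R - 1) / (8 * s.+1%:R - 6) * ln (double_star_base s.+1)).
Proof.
move=> s15; have c0 := max_colorings_star_gt0 s 2 n.
have [G cG] := max_colorings_attained s.+1 (star 3) n.
have := num_colorings_star3 G (exp_le_fact R s15); rewrite card_ord -cG.
have X0 : 0 < double_star_base s.+1 by exact: double_star_base_gt0.
rewrite -(ler_nat R) !natrX vertex_weight_double_star.
move=> h; rewrite -ler_ln ?posrE ?exprn_gt0 ?ltr0n // in h.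
rewrite !lnXn ?exprn_gt0 ?ltr0n // -!(mulr_natr (ln _)) -(mulr_natr (_ * _)) in h; move: h.
have -> : (2 * (2 * (2 * s).+1 - 1))%:R = 8 * s.+1%:R - 6 :> R.
  rewrite (_ : 2 * (2 * (2 * s).+1 - 1) = 8 * s + 2)%N; last by lia.
  by rewrite natrD natrM -[s.+1%:R]natr1; ring.
have -> : (2 * s).+1%:R = 2 * s.+1%:R - 1 :> R.
  by rewrite -natr1 natrM -[s.+1%:R]natr1; ring.
have r1 : 1 <= s.+1%:R :> R by rewrite ler1n.
move: (ln (double_star_base _)) (ln _%:R) => X c h.
rewrite (_ : _ * _ = X * (2 * s.+1%:R - 1) * n%:R / (8 * s.+1%:R - 6)); last by ring.
by rewrite ler_pdivlMr //; lra.
Qed.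

End Asymptotics.

Unset Implicit Arguments.
Local Open Scope ring_scope.

Theorem theorem10 (R : realType) :
  let bound : nat -> R := fun r =>
    (r%:R * ((2 * r - 1)`!)%:R ^+ 2 / 2 ^+ (2 * r - 2))
      `^ ((2 * r%:R - 1) / (8 * r%:R - 6)) in
  let const : R := 2 `^ (1 / 8) / expR (1 / 4) in
  (exists r0 : nat, forall r : nat, (r0 <= r)%N ->
     cvgn (colorings_root R r (star 3)) /\
     (growth_rate R r (star 3) <= (bound r)%:E)%E) /\
  (bound ~_\oo
     (fun r : nat => const * (((2 * r)`!)%:R / 2 ^+ r) `^ (1 / 2))) /\
  `|const - 85 / 100| < 5 / 1000.
Proof.
move=> bound const; split; last first.
  by split; [exact: double_star_base_equivalent | exact: const_bound].
(* Here [r = s.+1] with [s] at least 15, as [exp_le_fact] asks. *)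
exists 16 => -[//|s] s15.
rewrite /bound powR_expR ?double_star_base_gt0 //.
apply: growth_rate_supermul => n.
- exact: max_colorings_star_gt0.
- by move=> m; exact: max_colorings_star_supermul.
exact: ln_max_colorings_star3.
Qed.
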